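(* Let $(X,\triangleright_{z_{ij}})$ be a $p$-rack with parameter set $Y\subseteq X$, and let $R^{z_{ij}}:X\times X\to X\times X$ be the $p$-rack solution $R^{z_{ij}}(b,a)=(b,\,b\triangleright_{z_{ij}}a)$ for all $a,b\in X$, $z_i,z_j\in Y$. For every $z\in Y$ let $K^z:X\to X$, $a\mapsto\kappa^z(a)$, be a bijective map. Then $K^z$ is a reflection if and only if, for all $a,b\in X$ and $z_i,z_j\in Y$, (i) $a\triangleright_{z_{ij}}\kappa^{z_j}(b)=\kappa^{z_j}(a\triangleright_{z_{i\bar j}}b)$, (ii) $\kappa^{z_i}(a)\triangleright_{z_{ij}}b=a\triangleright_{z_{\bar ij}}b$.
   Context: $X$ and $Y\subseteq X$ are non-empty sets; a superscript or subscript $z_{ij}$ denotes dependence on the ordered pair $(z_i,z_j)\in Y\times Y$. $\mu:Y\to Y$ is a fixed involutive map and $z_{\bar i}:=\mu(z_i)$; thus e.g. $z_{i\bar j}$ means dependence on $(z_i,\mu(z_j))$. $(X,\triangleright_{z_{ij}})$ is a (left) $p$-shelf if $a\triangleright_{z_{ik}}(b\triangleright_{z_{jk}}c)=(a\triangleright_{z_{ij}}b)\triangleright_{z_{jk}}(a\triangleright_{z_{ik}}c)$ for all $a,b,c\in X$, $z_i,z_j,z_k\in Y$; it is a (left) $p$-rack if moreover all maps $L_a^{z_{ij}}:b\mapsto a\triangleright_{z_{ij}}b$ are bijective. Given $R^{z_{ij}}:X\times X\to X\times X$, put $R_{12}^{z_{ij}}=R^{z_{ij}}$ and $R_{21}^{z_{ij}}=\pi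 R^{z_{ij}}\pi$ with $\pi(x,y)=(y,x)$. Put $K_1^z(a,b)=(\kappa^z(a),b)$ and $K_2^z(a,b)=(a,\kappa^z(b))$. The family $K^z$ $(z\in Y)$ is a (parametric) reflection (for $R$) if for all $z_1,z_2\in Y$ the following identity of maps on $X\times X$ (products denote composition) holds: $$R_{12}^{z_{12}}K_1^{z_1}R_{21}^{z_{2\bar1}}K_2^{z_2}=K_2^{z_2}R_{12}^{z_{1\bar2}}K_1^{z_1}R_{21}^{z_{\bar2\bar1}}.$$ *)

(* Defs.v *)
From mathcomp Require Import all_boot.
From mathcomp Require Import boolp classical_sets.

Set Implicit Arguments.
Unset Strict Implicit.
Unset Printing Implicit Defensive.

Local Open Scope classical_set_scope.

(* [op zi zj a b] is a |>_{z_ij} b. The parameters range over the set Y,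
   coerced to the type [set_type Y] of its elements. *)

Definition p_shelf (X : Type) (Y : set X) (op : Y -> Y -> X -> X -> X) : Prop :=
  forall (zi zj zk : Y) (a b c : X),
    op zi zk a (op zj zk b c) = op zj zk (op zi zj a b) (op zi zk a c).

Definition p_rack (X : Type) (Y : set X) (op : Y -> Y -> X -> X -> X) : Prop :=
  p_shelf op /\ forall (zi zj : Y) (a : X), bijective (op zi zj a).

Definition p_rack_solution (X : Type) (Y : set X) (op : Y -> Y -> X -> X -> X)
    (zi zj : Y) (p : X * X) : X * X :=
  (p.1, op zi zj p.1 p.2).

Definition R12 (X : Type) (Y : set X) (R : Y -> Y -> X * X -> X * X)
    (zi zj : Y) : X * X -> X * X :=
  R zi zj.

(* The superscripts are not exchanged: R_21^{z_ij} = pi R^{z_ij} pi. *)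
Definition R21 (X : Type) (Y : set X) (R : Y -> Y -> X * X -> X * X)
    (zi zj : Y) : X * X -> X * X :=
  swap_pair \o R zi zj \o swap_pair.

Definition K1 (X : Type) (Y : set X) (kappa : Y -> X -> X)
    (z : Y) (p : X * X) : X * X :=
  (kappa z p.1, p.2).

Definition K2 (X : Type) (Y : set X) (kappa : Y -> X -> X)
    (z : Y) (p : X * X) : X * X :=
  (p.1, kappa z p.2).

Definition reflection (X : Type) (Y : set X) (mu : Y -> Y)
    (R : Y -> Y -> X * X -> X * X) (kappa : Y -> X -> X) : Prop :=
  forall z1 z2 : Y,
    R12 R z1 z2 \o K1 kappa z1 \o R21 R z2 (mu z1) \o K2 kappa z2
    =1 K2 kappa z2 \o R12 R z1 (mu z2) \o K1 kappa z1
       \o R21 R (mu z2) (mu z1).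

(* Main.v *)
(* Evaluated at (a, b), the first components of the two sides of the reflection
   equation are kappa^{z_1} of the two sides of (ii), so they agree iff (ii)
   holds, by injectivity of kappa. The second components then give (i) at the
   left argument kappa^{z_1}(b |>_{\bar 2 \bar 1} a), which runs over all of X
   as a does, by surjectivity of kappa and of the left translations. *)
Require Import Defs.
From mathcomp Require Import all_boot.
From mathcomp Require Import boolp classical_sets.

Local Open Scope classical_set_scope.

Theorem corollary2p3 (X : Type) (Y : set X) (hX : [set: X] !=set0)
    (hY : Y !=set0) (mu : Y -> Y) (hmu : involutive mu)
    (op : Y -> Y -> X -> X -> X) (hop : p_rack op)
    (kappa : Y -> X -> X) (hkappa : forall z : Y, bijective (kappa z)) :
  reflection mu (p_rack_solution op) kappa <->
  (forall (a b : X) (zi zj : Y),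
     op zi zj a (kappa zj b) = kappa zj (op zi (mu zj) a b) /\
     op zi zj (kappa zi a) b = op (mu zi) zj a b).
Proof.
split=> [refl | cond z1 z2 [a b]]; last first.
  rewrite /R12 /R21 /K1 /K2 /p_rack_solution /=.
  have [_ ->] := cond b a z2 (mu z1).
  (* Once (ii) has been applied, both sides have the same first component [c], and [c] acts in both
     second components, so (i) at [c] closes the goal. *)
  set c := kappa z1 _.
  by have [-> _] := cond c b z1 z2.
have condii zi zj a b : op zi zj (kappa zi a) b = op (mu zi) zj a b.
  (* The reflection equation bars its first parameter, so starting from [mu zj] yields [zj] by
     involutivity; [R21] lets the second entry [a] act on [b]. *)
  have [/(bij_inj (hkappa _)) + _] := refl (mu zj) zi (b, a).
  by rewrite /= hmu.
move=> a b zi zj; split; last exact: condii.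
have [k _ kK] := hkappa zi.
have [l _ lK] := hop.2 (mu zj) (mu zi) b.
(* With this first entry the left argument on both sides, after (ii) on one of them, is
   [kappa zi (k a)], that is [a]. *)
have [_] := refl zi zj (l (k a), b).
by rewrite /= (condii zj) lK kK.
Qed.
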